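(* Every trivially perfect graph is $\mathsf{LF}$-coverable.
   Context: All graphs are finite, simple and undirected. A graph is trivially perfect if it can be constructed inductively, starting from a single vertex $K_1$, via either the disjoint union of smaller trivially perfect graphs, or the addition of a new vertex adjacent to all vertices of a smaller trivially perfect graph. A linear forest is a graph every connected component of which is a path (a single vertex is a path). A linear forest in $G$ is a subgraph of $G$ that is a linear forest; it is called maximal if no other linear forest in $G$ has a greater number of edges. $\mathsf{LF}$-cover: let $F$ be a maximal linear forest in $G$ and $S\subseteq V(F)$. The pair $(F,S)$ is an $\mathsf{LF}$-cover of $G$ if: (1) no vertex in $S$ is a leaf of $F$, where a leaf of $F$ means a vertex of degree at most $1$ in $F$ (so isolated vertices of $F$ count as leaves); (2) no two vertices in $S$ are adjacent in $F$; (3) for every edge $\{i,j\}\in E(G)$, either at least one of $i,j$ belongs to $S$, or both $i$ and $j$ belong to the same connected component of $F\setminus S$. $G$ is $\mathsf{LF}$-coverable if it has an $\mathsf{LF}$-cover. *)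

(* Defs.v *)
From mathcomp Require Import all_boot.

Set Implicit Arguments.
Unset Strict Implicit.
Unset Printing Implicit Defensive.

Record sgraph : Type := SGraph {
  vertex :> finType;
  adj : rel vertex;
  adj_sym : symmetric adj;
  adj_irr : irreflexive adj
}.
Arguments adj {_} _ _.

Definition giso (G H : sgraph) : Prop :=
  exists2 f : G -> H, bijective f & forall x y : G, adj (f x) (f y) = adj x y.

Definition K1_adj : rel unit := fun _ _ => false.

Lemma K1_sym : symmetric K1_adj. Proof. by []. Qed.
Lemma K1_irr : irreflexive K1_adj. Proof. by []. Qed.

Definition K1 : sgraph := SGraph K1_sym K1_irr.

Definition union_adj (G H : sgraph) : rel (G + H)%type := fun u v =>
  match u, v with
  | inl x, inl y => adj x y
  | inr x, inr y => adj x y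
  | _, _ => false
  end.

Lemma union_sym (G H : sgraph) : symmetric (@union_adj G H).
Proof. by case=> x [] y //=; apply: adj_sym. Qed.

Lemma union_irr (G H : sgraph) : irreflexive (@union_adj G H).
Proof. by case=> x; apply: adj_irr. Qed.

Definition disjoint_union (G H : sgraph) : sgraph :=
  SGraph (@union_sym G H) (@union_irr G H).

(* The new vertex is [None]. *)
Definition dominate_adj (G : sgraph) : rel (option G) := fun u v =>
  match u, v with
  | Some x, Some y => adj x y
  | None, None => false
  | _, _ => true
  end.

Lemma dominate_sym (G : sgraph) : symmetric (@dominate_adj G).
Proof. by case=> [x|] [y|] //=; rewrite adj_sym. Qed.

Lemma dominate_irr (G : sgraph) : irreflexive (@dominate_adj G).
Proof. by case=> [x|] //=; rewrite adj_irr. Qed.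

Definition add_dominating (G : sgraph) : sgraph :=
  SGraph (@dominate_sym G) (@dominate_irr G).

(* Disjoint unions of several graphs are iterated binary ones.  [tp_iso] makes
   the class independent of the concrete vertex types.  The empty graph is not
   trivially perfect. *)
Inductive trivially_perfect : sgraph -> Prop :=
| tp_K1 : trivially_perfect K1
| tp_union (G H : sgraph) :
    trivially_perfect G -> trivially_perfect H ->
    trivially_perfect (disjoint_union G H)
| tp_dominating (G : sgraph) :
    trivially_perfect G -> trivially_perfect (add_dominating G)
| tp_iso (G H : sgraph) :
    giso G H -> trivially_perfect G -> trivially_perfect H.

(* Subgraphs need be neither spanning nor induced. *)
Record subgraph (G : sgraph) : Type := Subgraph {
  sub_vertices : {set G};
  sub_adj : rel G;
  sub_adj_sym : symmetric sub_adj;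
  sub_adj_adj : forall x y : G, sub_adj x y -> adj x y;
  sub_adj_vertices : forall x y : G, sub_adj x y -> x \in sub_vertices
}.

Section Subgraphs.
Variable G : sgraph.
Implicit Types (F : subgraph G) (S C : {set G}).

Definition sub_edges F : {set {set G}} :=
  [set [set x; y] | x in sub_vertices F, y in sub_adj F x].

Definition sub_degree F (x : G) : nat := #|[set y | sub_adj F x y]|.

Definition component F (x : G) : {set G} :=
  [set y in sub_vertices F | connect (sub_adj F) x y].

Definition same_component F (x y : G) : Prop :=
  x \in sub_vertices F /\ y \in component F x.

Definition delete_adj F S : rel G :=
  fun x y => [&& x \notin S, y \notin S & sub_adj F x y].

Lemma delete_sym F S : symmetric (delete_adj F S).
Proof. by move=> x y; rewrite /delete_adj sub_adj_sym andbCA. Qed.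

Lemma delete_adj_adj F S (x y : G) : delete_adj F S x y -> adj x y.
Proof. by case/and3P=> _ _; apply: sub_adj_adj. Qed.

Lemma delete_adj_vertices F S (x y : G) :
  delete_adj F S x y -> x \in sub_vertices F :\: S.
Proof. by case/and3P=> xS _ /sub_adj_vertices xF; rewrite inE xS. Qed.

Definition delete F S : subgraph G :=
  Subgraph (@delete_sym F S) (@delete_adj_adj F S) (@delete_adj_vertices F S).

(* The subgraph of F induced on C is a path: the vertices of C are listed
   without repetition by a nonempty sequence, and two of them are adjacent in F
   exactly when they are consecutive in it. *)
Definition induces_path F C : Prop :=
  exists x0 : G, exists s : seq G,
    let p := x0 :: s in
    [/\ uniq p, C =i p &
        {in p &, forall x y : G,
           sub_adj F x y = (index y p == (index x p).+1)
                           || (index x p == (index y p).+1)}].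

Definition linear_forest F : Prop :=
  forall x : G, x \in sub_vertices F -> induces_path F (component F x).

Definition maximal_linear_forest F : Prop :=
  linear_forest F /\
  forall F' : subgraph G, linear_forest F' -> #|sub_edges F'| <= #|sub_edges F|.

(* Isolated vertices of F count as leaves. *)
Definition leaf F (x : G) : bool :=
  (x \in sub_vertices F) && (sub_degree F x <= 1).

Definition LF_cover F S : Prop :=
  [/\ maximal_linear_forest F,
      S \subset sub_vertices F,
      {in S, forall x : G, ~~ leaf F x},
      {in S &, forall x y : G, ~~ sub_adj F x y} &
      forall x y : G, adj x y ->
        [\/ x \in S, y \in S | same_component (delete F S) x y]].

Definition LF_coverable : Prop :=
  exists F : subgraph G, exists S : {set G}, LF_cover F S.

End Subgraphs.

(* Main.v *)
Require Import Defs.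
From mathcomp Require Import all_boot.

(** An LF-cover certifies its own maximality.  Suppose that (F, S) satisfies
    the conditions of an LF-cover other than maximality.  A linear forest F'
    has degree at most 2, so at most 2|S| of its edges meet S; since S is
    independent in F and has no leaf of F, at least 2|S| edges of F meet S.
    Every other edge of F' lies inside a component of F minus S; being acyclic,
    F' has at most |D| - 1 edges inside a component D, and F has at least that
    many because D is connected in F minus S.  Hence F' has no more edges than
    F ([LF_conditions_maximal]).

    It remains to build F and S, by induction on the construction of the graph,
    with F spanning.  A disjoint union takes the union of the covers.  Let v be
    a new dominating vertex.  If F has at least two paths, v joins an end of
    one to an end of another and enters S: all new edges are covered by v, and
    the neighbours of v in F, being former ends, are not in S.  If F is a single
    path, then adding v at an end gives a Hamiltonian path, and a Hamiltonian
    path with S empty satisfies all conditions ([path_cover_dominating]). *)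

Set Implicit Arguments.
Unset Strict Implicit.
Unset Printing Implicit Defensive.

(** * Counting edges of forests and of connected graphs *)

Section LFMaximality.
Variable G : sgraph.
Implicit Types (F K : subgraph G) (S : {set G}).

Lemma sub_edgesP F (A : {set G}) :
  reflect (exists x y, sub_adj F x y /\ A = [set x; y]) (A \in sub_edges F).
Proof.
apply: (iffP imset2P) => [[x y _ xy ->]|[x [y [xy ->]]]].
  by exists x, y.
by exists x y => //; exact: sub_adj_vertices xy.
Qed.

Lemma mem_sub_edges F (x y : G) : sub_adj F x y -> [set x; y] \in sub_edges F.
Proof. by move=> xy; apply/sub_edgesP; exists x, y. Qed.

Lemma sub_connect_sym F : connect_sym (sub_adj F).
Proof. exact: sym_connect_sym (@sub_adj_sym _ F). Qed.

(** Such a rank exists exactly when F is acyclic.  Orienting each edge downwards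
    in rank, an edge is determined by its upper end, and a vertex of least rank
    in its component of K is no upper end, since the edges of F stay inside the
    components of K.  Each component of K contains at least one such vertex. *)
Lemma ranked_edges_bound F K (r : G -> nat) :
    (forall x y, sub_adj F x y -> r x != r y) ->
    (forall x y z, sub_adj F x y -> sub_adj F x z ->
       r y < r x -> r z < r x -> y = z) ->
    (forall x y, sub_adj F x y -> connect (sub_adj K) x y) ->
  #|sub_edges F| + #|[set x in roots (sub_adj K)]| <= #|G|.
Proof.
move=> r_neq r_uniq FK; set e := sub_adj K.
pose low x y := sub_adj F x y && (r y < r x).
pose U := [set x | [exists y, low x y]].
pose M := [set x | [forall y, connect e x y ==> (r x <= r y)]].
pose edge x := [set x; odflt x [pick y | low x y]].
have edgeE x y : low x y -> edge x = [set x; y].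
  move=> xy; rewrite /edge; case: pickP => [z /andP[xz zx]|/(_ y)] /=.
    by case/andP: xy => xy yx; rewrite (r_uniq x z y).
  by rewrite xy.
have leE : #|sub_edges F| <= #|U|.
  apply: leq_trans (leq_imset_card edge _).
  apply/subset_leq_card/subsetP => A /sub_edgesP[x [y [xy ->]]].
  wlog ltyx : x y xy / r y < r x => [th|].
    case: (ltngtP (r x) (r y)) => [lt|lt|/eqP eq].
    - by rewrite setUC; apply: th lt; rewrite sub_adj_sym.
    - exact: th.
    - by rewrite (negPf (r_neq _ _ xy)) in eq.
  have lo : low x y by rewrite /low xy.
  by rewrite -(edgeE _ _ lo) imset_f // inE; apply/existsP; exists y.
have leM : #|[set x in roots e]| <= #|M|.
  apply: leq_trans (leq_imset_card (root e) _).
  apply/subset_leq_card/subsetP => x; rewrite inE => /eqP rootx.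
  case: (@arg_minnP _ x (connect e x) r (connect0 _ _)) => m xm min_m.
  apply/imsetP; exists m.
    rewrite inE; apply/forallP => y; apply/implyP => my.
    exact: min_m (connect_trans xm my).
  by rewrite -[LHS]rootx; apply/(rootP (@sub_connect_sym K)).
have disj : U :&: M = set0.
  apply/setP => x; rewrite !inE; apply/negP => /andP[/existsP[y /andP[xy lt]]].
  by move/forallP/(_ y); rewrite FK //= leqNgt lt.
apply: leq_trans (leq_add leE leM) _.
by rewrite -cardsUI disj cards0 addn0 max_card.
Qed.

(** Each vertex other than the chosen root of its component has a neighbour
    closer to that root, and the edges to these neighbours are distinct. *)
Lemma connected_edges_bound K :
  #|G| <= #|sub_edges K| + #|[set x in roots (sub_adj K)]|.
Proof.
set e := sub_adj K.
pose walk x n := [exists p : n.-tuple G, path e x p && (last x p == root e x)].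
have exw x : exists n, walk x n.
  have /connectP[p ep lp] := connect_root e x.
  by exists (size p); apply/existsP; exists (in_tuple p); rewrite /= ep -lp eqxx.
pose d x := ex_minn (exw x).
have closer x : x \notin roots e -> exists y, e x y && (d y < d x).
  move=> nroot; rewrite {2}/d; case: ex_minnP => n /existsP[[p /= /eqP sz]].
  case: p sz => [|y p] /= sz.
    by move=> /eqP xr; case/negP: nroot; apply/eqP.
  case/andP=> /andP[xy yp] /eqP lp _; exists y; rewrite xy -sz ltnS /d.
  case: ex_minnP => m _; apply; apply/existsP; exists (in_tuple p).
  rewrite /= yp lp /=; apply/eqP/(rootP (@sub_connect_sym K)).
  exact: connect1.
pose parent x := odflt x [pick y | e x y && (d y < d x)].
have parentP x : x \notin roots e -> e x (parent x) && (d (parent x) < d x).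
  move=> /closer[y xy]; rewrite /parent.
  by case: pickP => [z ->|/(_ y)] //=; rewrite xy.
pose edge x := [set x; parent x].
have inj : {in ~: [set x in roots e] &, injective edge}.
  move=> x y; rewrite 2!inE => /parentP/andP[_ dx].
  rewrite 2!inE => /parentP/andP[_ dy] eqe.
  have : x \in edge y by rewrite -eqe set21.
  have : y \in edge x by rewrite eqe set21.
  (* If x != y, each of them is the parent of the other. *)
  rewrite !inE => /orP[/eqP->//|/eqP yp] /orP[/eqP//|/eqP xp].
  by rewrite -yp in dx; rewrite -xp in dy; have := ltn_trans dx dy; rewrite ltnn.
rewrite -(cardsC [set x in roots e]) addnC leq_add2r -(card_in_imset inj).
apply/subset_leq_card/subsetP => A /imsetP[x + ->].
by rewrite 2!inE => /parentP/andP[xp _]; apply: mem_sub_edges.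
Qed.

(** * Maximality *)

(** The rank of a vertex is its position along its component path. *)
Lemma linear_forest_rank F : linear_forest F -> exists r : G -> nat,
  (forall x y, sub_adj F x y -> (r y == (r x).+1) || (r x == (r y).+1)) /\
  (forall x y z, sub_adj F x y -> sub_adj F x z -> r y = r z -> y = z).
Proof.
move=> linF; set e := sub_adj F; set V := sub_vertices F.
pose lists x p := component F x =i p /\ {in p &, forall y z : G,
  e y z = (index z p == (index y p).+1) || (index y p == (index z p).+1)}.
have [f fP] : exists f : G -> seq G, forall x, x \in V -> lists x (f x).
  apply: (@fin_all_exists _ _ (fun x p => x \in V -> lists x p)) => x.
  case: (boolP (x \in V)) => [/linF[x0 [s [_ Cp ep]]]|_]; last by exists [::].
  by exists (x0 :: s).
have csym := @sub_connect_sym F.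
have listed x y : e x y -> lists (root e x) (f (root e x)) /\
    (x \in f (root e x) /\ y \in f (root e x)).
  move=> xy; have yx : e y x by rewrite /e sub_adj_sym.
  have clV : closed e V.
    by apply: intro_closed => // a b + _; rewrite /e sub_adj_sym;
      apply: sub_adj_vertices.
  have Vx : x \in V := sub_adj_vertices xy.
  have Vy : y \in V := sub_adj_vertices yx.
  have Vr : root e x \in V by rewrite -(closed_connect clV (connect_root e x)).
  have lf := fP _ Vr; have [Cf _] := lf.
  have rx : connect e (root e x) x by rewrite csym connect_root.
  have ry := connect_trans rx (connect1 xy).
  by split=> //; split; rewrite -Cf inE; apply/andP.
exists (fun x => index x (f (root e x))); split=> [x y xy|x y z xy xz].
  have /(rootP csym) <- := connect1 xy.
  by have [[_ ef] [xf yf]] := listed _ _ xy; rewrite -ef.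
have /(rootP csym) <- := connect1 xy; have /(rootP csym) <- := connect1 xz.
have [_ [_ yf]] := listed _ _ xy; have [_ [_ zf]] := listed _ _ xz.
by move=> eqi; rewrite -(nth_index x yf) eqi nth_index.
Qed.

(** The neighbours of a vertex of rank n have ranks among n - 1 and n + 1, and
    no two of them share a rank. *)
Lemma linear_forest_degree F (x : G) : linear_forest F -> sub_degree F x <= 2.
Proof.
case/linear_forest_rank=> r [r_step r_uniq].
have inj : {in [set y | sub_adj F x y] &, injective r}.
  by move=> y z; rewrite !inE; apply: r_uniq.
rewrite /sub_degree cardE -(size_map r).
apply: (@uniq_leq_size _ _ [:: (r x).+1; (r x).-1]) => [|n].
  by rewrite map_inj_in_uniq ?enum_uniq // => y z; rewrite !mem_enum; apply: inj.
case/mapP=> y; rewrite mem_enum inE => /r_step/orP[/eqP->|/eqP->] ->;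
by rewrite !inE eqxx ?orbT.
Qed.

(** The edges meeting S are the images of the pairs of a vertex of S and a
    neighbour of it. *)
Lemma edges_meeting F S :
  sub_edges F :\: sub_edges (delete F S) =
  [set [set u.1; u.2] | u in [set u : G * G | (u.1 \in S) && sub_adj F u.1 u.2]].
Proof.
apply/setP => A; rewrite inE; apply/andP/imsetP => [[]|[[x y]]].
  move=> nA /sub_edgesP[x [y [xy eA]]].
  case: (boolP (x \in S)) => [xS|xS]; first by exists (x, y); rewrite ?inE ?xS.
  case: (boolP (y \in S)) => [yS|yS].
    by exists (y, x); rewrite ?inE /= ?yS 1?sub_adj_sym // setUC.
  by case/negP: nA; rewrite eA mem_sub_edges //= /delete_adj xS yS.
rewrite inE /= => /andP[xS xy] ->; split; last exact: mem_sub_edges.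
apply/negP => /sub_edgesP[a [b [/and3P[aS bS _] eqe]]].
have : x \in [set a; b] by rewrite -eqe set21.
by rewrite !inE => /orP[/eqP xa|/eqP xb]; [move: aS | move: bS];
  rewrite -?xa -?xb xS.
Qed.

Lemma card_incidences F S :
  #|[set u : G * G | (u.1 \in S) && sub_adj F u.1 u.2]| =
  \sum_(x in S) sub_degree F x.
Proof.
under eq_bigr do rewrite /sub_degree -sum1_card.
rewrite -sum1_card pair_big_dep /=; apply: eq_bigl => u.
by rewrite !inE.
Qed.

Lemma card_sub_edges_delete F S : #|sub_edges F| =
  #|sub_edges (delete F S)| + #|sub_edges F :\: sub_edges (delete F S)|.
Proof.
rewrite -(cardsID (sub_edges (delete F S))) (setIidPr _) //.
apply/subsetP => A /sub_edgesP[x [y [/and3P[_ _ xy] ->]]].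
exact: mem_sub_edges.
Qed.

(** The edges meeting S and those avoiding it are compared separately: the
    former by degrees, the latter by comparing both numbers of edges with the
    number of vertices minus the number of components of F minus S. *)
Lemma LF_conditions_maximal F S F' :
    S \subset sub_vertices F ->
    {in S, forall x : G, ~~ leaf F x} ->
    {in S &, forall x y : G, ~~ sub_adj F x y} ->
    (forall x y : G, adj x y ->
      [\/ x \in S, y \in S | same_component (delete F S) x y]) ->
  linear_forest F' -> #|sub_edges F'| <= #|sub_edges F|.
Proof.
move=> SV nleaf indep cover linF'.
rewrite (card_sub_edges_delete F S) (card_sub_edges_delete F' S) leq_add //.
  rewrite -(leq_add2r #|[set x in roots (sub_adj (delete F S))]|).
  have [r [r_step r_uniq]] := linear_forest_rank linF'.
  apply: leq_trans (connected_edges_bound _).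
  apply: (@ranked_edges_bound _ _ r) => [x y /and3P[_ _ /r_step]|x y z|x y].
  - by case/orP=> /eqP->; rewrite neq_ltn ltnSn ?orbT.
  - case/and3P=> _ _ xy /and3P[_ _ xz] yx zx; apply: (r_uniq _ _ _ xy xz).
    case/orP: (r_step _ _ xy) yx => /eqP exy; first by rewrite exy ltnNge leqnSn.
    case/orP: (r_step _ _ xz) zx => /eqP exz; first by rewrite exz ltnNge leqnSn.
    by move: exy; rewrite exz => -[].
  - move=> /and3P[xS yS xy].
    case: (cover _ _ (sub_adj_adj xy)) => [||[_]]; rewrite ?(negPf xS) ?(negPf yS) //.
    by rewrite inE => /andP[].
rewrite !edges_meeting.
apply: leq_trans (leq_imset_card _ _) _.
rewrite [leqRHS]card_in_imset.
  rewrite !card_incidences; apply: leq_sum => x xS.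
  (* F has no leaf in S, so its degree there is at least 2. *)
  apply: leq_trans (linear_forest_degree x linF') _.
  by have := nleaf x xS; rewrite /leaf (subsetP SV) //= -ltnNge.
(* S is independent in F: an edge of F has at most one end in S. *)
move=> [x y] [x' y']; rewrite !inE /= => /andP[xS xy] /andP[xS' xy'] eqe.
have : x \in [set x'; y'] by rewrite -eqe set21.
have : y \in [set x'; y'] by rewrite -eqe set22.
have ny : y \notin S by apply: contraL xy => yS; apply: indep.
have ny' : y' \notin S by apply: contraL xy' => yS; apply: indep.
rewrite !inE => /orP[/eqP yx|/eqP->]; first by rewrite yx xS' in ny.
by case/orP=> /eqP xE; [rewrite xE | rewrite -xE xS in ny'].
Qed.

End LFMaximality.

(** * Covers given by lists of paths *)

(** Since the ends of p avoid S, no vertex of S on p is a leaf, and p can later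
    be extended at an end by a vertex of S. *)
Definition separated_path (G : sgraph) (S : pred G) (p : seq G) : bool :=
  if p is x :: q then
    [&& ~~ S x, ~~ S (last x q)
      & path (fun a b => adj a b && ~~ (S a && S b)) x q]
  else false.

(** Once the vertices in S are deleted, the components of a path are its maximal
    S-free infixes, so x and y lie in one of them when they share an S-free
    infix. *)
Definition in_block (T : eqType) (S : pred T) (ps : seq (seq T)) (x y : T) :=
  exists q p, [/\ p \in ps, infix q p, x \in q, y \in q & all (predC S) q].

Definition path_cover (G : sgraph) (ps : seq (seq G)) (S : pred G) : Prop :=
  [/\ uniq (flatten ps), forall x, x \in flatten ps, all (separated_path S) ps
    & forall x y : G, adj x y -> [\/ S x, S y | in_block S ps x y]].

Lemma flatten_uniq_inj (T : eqType) (ps : seq (seq T)) (p q : seq T) (x : T) :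
  uniq (flatten ps) -> p \in ps -> q \in ps -> x \in p -> x \in q -> p = q.
Proof.
elim: ps => //= r ps IH; rewrite cat_uniq => /and3P[_ /hasPn disj uq].
have out s : s \in ps -> x \in s -> x \notin r.
  by move=> sps xs; apply: disj; apply/flattenP; exists s.
rewrite !inE => /orP[/eqP->|pps] /orP[/eqP->|qps] xp xq //.
- by have := out _ qps xq; rewrite xp.
- by have := out _ pps xp; rewrite xq.
- exact: IH.
Qed.

Section PathForest.
Variables (G : sgraph) (ps : seq (seq G)) (S : pred G).
Hypotheses (Ups : uniq (flatten ps)) (ps_all : forall x, x \in flatten ps).
Hypothesis ps_sep : all (separated_path S) ps.

Let consecutive (p : seq G) (x y : G) : bool :=
  (index y p == (index x p).+1) || (index x p == (index y p).+1).

Definition link (x y : G) : bool :=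
  has (fun p => [&& x \in p, y \in p & consecutive p x y]) ps.

Lemma link_sym : symmetric link.
Proof.
by move=> x y; apply: eq_has => p; rewrite andbCA /consecutive orbC.
Qed.

Let uniq_path p : p \in ps -> uniq p.
Proof.
elim: ps Ups => //= q qs IH; rewrite cat_uniq inE => /and3P[uq _ /IH uqs].
by case/orP=> [/eqP->|].
Qed.

Lemma link_in p x y : p \in ps -> x \in p -> y \in p ->
  link x y = consecutive p x y.
Proof.
move=> pps xp yp; apply/hasP/idP => [[q qps /and3P[xq _]]|c].
  by rewrite (flatten_uniq_inj Ups qps pps xq xp).
by exists p => //; rewrite xp yp.
Qed.

Lemma link_closed p x y : p \in ps -> link x y -> (x \in p) = (y \in p).
Proof.
move=> pps /hasP[q qps /and3P[xq yq _]].
apply/idP/idP => [xp|yp].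
  by rewrite (flatten_uniq_inj Ups pps qps xp xq).
by rewrite (flatten_uniq_inj Ups pps qps yp yq).
Qed.

Lemma link_sorted p : p \in ps -> sorted link p.
Proof.
move=> pps; case Ep: p => [//|x0 s]; rewrite -Ep.
have up := uniq_path pps.
apply/(sortedP x0) => i lt_i; have lt_i' := ltnW lt_i.
by rewrite (@link_in p) ?mem_nth // /consecutive !index_uniq // eqxx.
Qed.

Lemma link_separated x y : link x y -> adj x y && ~~ (S x && S y).
Proof.
case/hasP=> p pps /and3P[]; case Ep: p => [//|x0 s]; rewrite -Ep /consecutive.
have srt : sorted (fun a b : G => adj a b && ~~ (S a && S b)) p.
  by have := allP ps_sep p pps; rewrite Ep /= => /and3P[].
wlog c : x y / index y p == (index x p).+1 => [th xp yp|xp yp _].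
  case/orP=> c; first by apply: th => //; rewrite c.
  by rewrite adj_sym andbC [S x && _]andbC andbC; apply: th => //; rewrite c.
have := sortedP x0 srt (index x p).
by rewrite -(eqP c) index_mem yp !nth_index //; apply.
Qed.

Definition path_forest : subgraph G :=
  @Subgraph G [set: G] link link_sym
    (fun x y xy => proj1 (andP (link_separated xy))) (fun x y _ => in_setT x).

Lemma sorted_connect (e : rel G) p x y :
  symmetric e -> sorted e p -> x \in p -> y \in p -> connect e x y.
Proof.
move=> sym_e; case: p => //= z q ep xp yp.
apply: (@connect_trans _ _ z); last exact: path_connect ep _ yp.
by rewrite (sym_connect_sym sym_e); apply: path_connect ep _ xp.
Qed.

Lemma path_forest_linear : linear_forest path_forest.
Proof.
move=> x _; have /flattenP[p pps xp] := ps_all x.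
case Ep: p => [|x0 s]; first by rewrite Ep in xp.
exists x0, s; rewrite -Ep /=; split; first exact: uniq_path.
  move=> y; rewrite !inE /=; apply/idP/idP => [xy|yp].
    have cl : closed link (mem p) by move=> a b; apply: link_closed.
    by rewrite -[_ \in _](closed_connect cl xy).
  exact: sorted_connect link_sym (link_sorted pps) xp yp.
by move=> y z yp zp; apply: link_in.
Qed.

(** A vertex of S lies strictly inside its path, between two neighbours. *)
Lemma path_forest_degree x : S x -> 2 <= sub_degree path_forest x.
Proof.
move=> Sx; have /flattenP[p pps xp] := ps_all x.
case Ep: p => [|x0 s]; first by rewrite Ep in xp.
have /and3P[nS0 nSl _] : separated_path S (x0 :: s) by rewrite -Ep (allP ps_sep).
have up := uniq_path pps; set i := index x p.
have lti : i < size p by rewrite index_mem.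
have i_gt0 : 0 < i.
  rewrite lt0n; apply: contraNneq nS0 => i0.
  by rewrite -[x0]/(nth x0 (x0 :: s) 0) -Ep -i0 nth_index.
have lti1 : i.+1 < size p.
  rewrite ltn_neqAle lti andbT; apply: contraNneq nSl => ei.
  by rewrite -[last x0 s]/(last x0 (x0 :: s)) -nth_last -Ep -ei nth_index.
have ltp : i.-1 < size p by rewrite (leq_ltn_trans (leq_pred _)).
pose a := nth x0 p i.-1; pose b := nth x0 p i.+1.
have ab : a != b by rewrite nth_uniq // neq_ltn (leq_ltn_trans (leq_pred i)).
have -> : 2 = #|[set a; b]| by rewrite cards2 ab.
apply/subset_leq_card/subsetP => y; rewrite !inE => /orP[]/eqP->.
  by rewrite /= (@link_in p) ?mem_nth // /consecutive !index_uniq // prednK // eqxx orbT.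
by rewrite /= (@link_in p) ?mem_nth // /consecutive !index_uniq // eqxx.
Qed.

Lemma in_block_same_component x y :
  in_block S ps x y -> same_component (delete path_forest [set z | S z]) x y.
Proof.
case=> q [p [pps qp xq yq /allP /= nSq]].
rewrite /same_component !inE !nSq //; split=> //=.
apply: sorted_connect xq yq; first exact: delete_sym.
have : sorted link q := infix_sorted qp (link_sorted pps).
apply: (sub_in_sorted (P := mem q)); last exact/allP.
by move=> a b aq bq ab; rewrite /= /delete_adj !inE; apply/and3P; split=> //; apply: nSq.
Qed.

End PathForest.

Lemma path_cover_LF_coverable (G : sgraph) ps (S : pred G) :
  path_cover ps S -> LF_coverable G.
Proof.
case=> Ups ps_all ps_sep cover.
pose F := path_forest ps_sep; pose SS := [set z | S z].
exists F, SS.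
have nleaf : {in SS, forall x : G, ~~ leaf F x}.
  by move=> x; rewrite inE /leaf inE -ltnNge; apply: path_forest_degree.
have indep : {in SS &, forall x y : G, ~~ sub_adj F x y}.
  move=> x y; rewrite !inE => Sx Sy; apply/negP => /(link_separated ps_sep).
  by rewrite Sx Sy andbF.
have coverF (x y : G) : adj x y ->
    [\/ x \in SS, y \in SS | same_component (delete F SS) x y].
  move=> /cover[Sx|Sy|xy]; first by constructor 1; rewrite inE.
    by constructor 2; rewrite inE.
  by constructor 3; apply: in_block_same_component.
have linF : linear_forest F by apply: path_forest_linear.
have SV : SS \subset sub_vertices F by apply: subsetT.
split=> //; split=> // F' linF'.
exact: LF_conditions_maximal SV nleaf indep coverF linF'.
Qed.

(** * Covers along the construction of trivially perfect graphs *)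

Section Embedding.
Variables (G H : sgraph) (h : G -> H) (S : pred G) (S' : pred H).
Hypotheses (hS : forall x, S' (h x) = S x).
Hypotheses (hadj : forall x y, adj (h x) (h y) = adj x y).

Lemma separated_map p : separated_path S p -> separated_path S' (map h p).
Proof.
case: p => //= x q /and3P[Sx Sl pq].
rewrite last_map !hS Sx Sl path_map.
by apply: sub_path pq => a b /=; rewrite hadj !hS.
Qed.

Lemma in_block_map ps x y :
  in_block S ps x y -> in_block S' (map (map h) ps) (h x) (h y).
Proof.
case=> q [p [pps /infixP[a [b ep]] xq yq nS]]; exists (map h q), (map h p).
split; rewrite ?map_f //.
  by rewrite ep !map_cat infix_infix.
by rewrite all_map; apply: sub_all nS => z /=; rewrite hS.
Qed.

Lemma all_separated_map ps :
  all (separated_path S) ps -> all (separated_path S') (map (map h) ps).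
Proof. by rewrite all_map; apply: sub_all => p; apply: separated_map. Qed.

End Embedding.

Definition path_coverable (G : sgraph) : Prop :=
  exists ps (S : pred G), path_cover ps S.

Lemma path_cover_K1 : path_coverable K1.
Proof. by exists [:: [:: tt]], xpred0; split=> // -[]. Qed.

Lemma path_cover_iso (G H : sgraph) :
  giso G H -> path_coverable G -> path_coverable H.
Proof.
case=> f bij_f fadj [ps [S [Ups ps_all ps_sep cover]]].
case: (bij_f) => g fK gK.
have fS x : (S \o g) (f x) = S x by rewrite /= fK.
exists (map (map f) ps), (S \o g); split.
- by rewrite -map_flatten map_inj_uniq //; apply: bij_inj.
- by move=> x; rewrite -map_flatten -[x]gK map_f.
- exact: all_separated_map ps_sep.
move=> x y; rewrite -[x]gK -[y]gK fadj => /cover[Sx|Sy|xy].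
- by constructor 1; rewrite fS.
- by constructor 2; rewrite fS.
- by constructor 3; apply: in_block_map xy.
Qed.

Lemma in_block_sub (T : eqType) (S : pred T) ps ps' x y :
  {subset ps <= ps'} -> in_block S ps x y -> in_block S ps' x y.
Proof. by move=> sub [q [p [/sub pps]]]; exists q, p. Qed.

Lemma path_cover_union (G H : sgraph) :
  path_coverable G -> path_coverable H -> path_coverable (disjoint_union G H).
Proof.
case=> ps [S [Ups ps_all ps_sep cover]] [qs [R [Uqs qs_all qs_sep cover']]].
pose il : G -> disjoint_union G H := inl; pose ir : H -> disjoint_union G H := inr.
pose SR : pred (disjoint_union G H) :=
  fun u => match u with inl x => S x | inr y => R y end.
exists (map (map il) ps ++ map (map ir) qs), SR; split.
- rewrite flatten_cat -!map_flatten cat_uniq !map_inj_uniq ?Ups ?Uqs //;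
    try by move=> ? ? [].
  by rewrite andbT; apply/hasPn => u /mapP[y _ ->]; apply/mapP => -[].
- by case=> x; rewrite flatten_cat -!map_flatten mem_cat ?(map_f il) ?(map_f ir) ?orbT.
- by rewrite all_cat !(@all_separated_map _ _ _ _ SR _ _ _ ps_sep)
    ?(@all_separated_map _ _ _ _ SR _ _ _ qs_sep).
case=> [x|x] [y|y] //= => [/cover|/cover'] [Sx|Sy|xy];
  try by [constructor 1 | constructor 2].
- constructor 3; apply: (in_block_sub (ps := map (map il) ps)).
    by move=> p pps; rewrite mem_cat pps.
  exact: (@in_block_map _ _ il S).
- constructor 3; apply: (in_block_sub (ps := map (map ir) qs)).
    by move=> p pps; rewrite mem_cat pps orbT.
  exact: (@in_block_map _ _ ir R).
Qed.

Lemma hamiltonian_path_cover (G : sgraph) (x : G) (q : seq G) :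
  uniq (x :: q) -> (forall y, y \in x :: q) -> path adj x q ->
  path_cover [:: x :: q] xpred0.
Proof.
move=> uq q_all pq; split; rewrite /= ?cats0 ?andbT //.
  by apply: sub_path pq => a b ->.
move=> a b _; constructor 3; exists (x :: q), (x :: q).
by split; rewrite ?q_all ?mem_head ?infix_refl ?all_predT.
Qed.

(** With at most one path in the cover, the whole graph is traversed by one path
    starting at the new vertex; otherwise the new vertex joins two paths and
    enters S. *)
Lemma path_cover_dominating (G : sgraph) :
  path_coverable G -> path_coverable (add_dominating G).
Proof.
case=> ps [S [Ups ps_all ps_sep cover]].
pose D := add_dominating G; pose v : D := None; pose h : G -> D := Some.
have h_inj : injective h by move=> ? ? [].
have short (p : seq G) : uniq p -> (forall x, x \in p) -> sorted adj p -> path_coverable D.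
  move=> up p_all ap; exists [:: v :: map h p], xpred0.
  apply: hamiltonian_path_cover.
  - by rewrite /= map_inj_uniq // up andbT; apply/mapP => -[].
  - by case=> [x|]; rewrite inE // (map_f h) ?orbT.
  - by case: p ap {up p_all} => //= x q; rewrite path_map.
case Eps: ps => [|p1 [|p2 rest]].
- by apply: (short [::]) => // x; have := ps_all x; rewrite Eps.
- apply: (short p1).
  + by move: Ups; rewrite Eps /= cats0.
  + by move=> x; have := ps_all x; rewrite Eps /= cats0.
  + move: ps_sep; rewrite Eps /= andbT; case: p1 {Eps} => //= x q /and3P[_ _].
    by apply: sub_path => a b /andP[].
(* There are at least two paths: v joins the end of p1 to the start of p2. *)
pose SD : pred D := fun u => if u is Some x then S x else true.
exists ((map h p1 ++ v :: map h p2) :: map (map h) rest), SD.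
have pm : perm_eq (flatten ((map h p1 ++ v :: map h p2) :: map (map h) rest))
    (v :: map h (flatten ps)).
  rewrite Eps /= !map_cat map_flatten -catA.
  exact/permEl/(perm_catCA (map h p1) [:: v]).
split.
- rewrite (perm_uniq pm) /= map_inj_uniq // Ups andbT.
  by apply/mapP => -[].
- by case=> [x|]; rewrite (perm_mem pm) inE // (map_f h) ?orbT.
- have := all_separated_map (h := h) (S' := SD) (fun=> erefl) (fun _ _ => erefl) ps_sep.
  rewrite Eps /= => /and3P[sep1 sep2 ->]; rewrite andbT.
  case: p1 p2 sep1 sep2 {Eps pm} => [|x1 q1] [|x2 q2] //=.
  case/and3P=> nS1 nl1 pq1 /and3P[nS2 nl2 pq2].
  rewrite last_cat cat_path /= nS1 nl2 pq1 pq2 /= nS2.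
  by rewrite last_map /= in nl1 *; rewrite (negPf nl1).
case=> [x|] [y|] //= => [/cover|_|_]; try by [constructor 1 | constructor 2].
case=> [Sx|Sy|xy]; try by [constructor 1 | constructor 2].
have [q [p [pps qp xq yq nS]]] :=
  in_block_map (h := h) (S' := SD) (fun=> erefl) xy.
constructor 3; move: pps; rewrite Eps /= !inE => /or3P[/eqP ep|/eqP ep|pps].
- exists q, (map h p1 ++ v :: map h p2).
  by split; rewrite ?mem_head //; apply: infix_catr; rewrite -ep.
- exists q, (map h p1 ++ v :: map h p2).
  split; rewrite ?mem_head // -cat_rcons; apply: infix_catl; by rewrite -ep.
- by exists q, p; split; rewrite // inE pps orbT.
Qed.

Theorem proposition2p23 (G : sgraph) : trivially_perfect G -> LF_coverable G.
Proof.
move=> tpG; suff [ps [S cov]] : path_coverable G.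
  exact: path_cover_LF_coverable cov.
elim: tpG => {G} [|G H _ + _|G _|G H iso _].
- exact: path_cover_K1.
- exact: path_cover_union.
- exact: path_cover_dominating.
- exact: path_cover_iso.
Qed.
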